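(* Assume that $f=[f_0:f_1]:\mathbb{R}\to\mathbb{TP}^1$ is a nonconstant tropical meromorphic function with $$\limsup_{r\to\infty}\frac{\log T_f(r)}{r}=0,$$ and $a_j=[a_{j1}:a_{j0}]$ $(j=1,\dots,q)$ are distinct values of $\mathbb{TP}^1$, defining tropical polynomials $P_j(x)=(a_{j0}\odot x_0)\oplus(a_{j1}\odot x_1)$ on $\mathbb{R}^2$, respectively. If $\mathrm{ddg}(\{P_3\circ f,\dots,P_q\circ f\})=\lambda$, then \begin{align*} (q-2-\lambda)T_f(r)&\le\sum_{j=1}^{q}N\bigl(r,1_o\oslash(P_j\circ f)\bigr)-N\bigl(r,1_o\oslash C_o(P_1\circ f,P_2\circ f)\bigr)+o(T_f(r))\\ &\le\sum_{j=3}^{q}N\bigl(r,1_o\oslash(P_j\circ f)\bigr)+o(T_f(r))\\ &\le(q-2)T_f(r)+o(T_f(r)), \end{align*} where $r$ approaches infinity outside an exceptional set of zero upper density measure. In the special case $\lambda=0$, \begin{align*} (q-2)T_f(r)&=\sum_{j=1}^{q}N\bigl(r,1_o\oslash(P_j\circ f)\bigr)-N\bigl(r,1_o\oslash C_o(P_1\circ f,P_2\circ f)\bigr)+o(T_f(r))\\ &=\sum_{j=3}^{q}N\bigl(r,1_o\oslash(P_j\circ f)\bigr)+o(T_f(r)), \end{align*} where $r$ approaches infinity outside an exceptional set of zero upper density measure.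
   Context: Tropical semiring: $\mathbb{R}_{\max}=\mathbb{R}\cup\{-\infty\}$ with $x\oplus y=\max(x,y)$, $x\odot y=x+y$, $x\oslash y=x-y$, $0_o=-\infty$, $1_o=0$. $\mathbb{TP}^1$ is $\mathbb{R}_{\max}^{2}\setminus\{(0_o,0_o)\}$ modulo $(a,b)\sim(\mu+a,\mu+b)$, $\mu\in\mathbb{R}$; it is identified with $\mathbb{R}\cup\{\pm\infty\}$ by letting $[a_1:a_0]$ correspond to $a=a_0\oslash a_1=a_0-a_1$ (so $-\infty=[1_o:0_o]$, $+\infty=[0_o:1_o]$). A tropical meromorphic function is a continuous piecewise linear $f:\mathbb{R}\to\mathbb{R}$ (possibly infinitely many pieces, derivative discontinuities locally finite). With $\omega_f(x)=\lim_{\varepsilon\to0+}\{f'(x+\varepsilon)-f'(x-\varepsilon)\}$, $x$ is a zero of multiplicity $\omega_f(x)$ if $\omega_f(x)>0$ and a pole of multiplicity $-\omega_f(x)$ if $\omega_f(x)<0$. A tropical entire function is a tropical meromorphic function without poles (equivalently, convex). $n(r,f)$ is the number of poles of $f$ in $(-r,r)$ counted with multiplicity, and $N(r,f)=\frac12\int_0^r n(t,f)\,dt$. So $N(r,1_o\oslash h)$, where $1_o\oslash h=-h$, counts the zeros of $h$. The notation $f=[f_0:f_1]$ means $f=f_1\oslash f_0=f_1-f_0$ with $f_0,f_1$ tropical entire functions without common zeros. With $\|f(x)\|=\max\{f_0(x),f_1(x)\}$, $T_f(r)=\frac12[\|f(r)\|+\|f(-r)\|]-\|f(0)\|$. $P_j\circ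 f=(a_{j0}\odot f_0)\oplus(a_{j1}\odot f_1)$. For $F=(b_0\odot f_0)\oplus(b_1\odot f_1)$ with $b_0,b_1\in\mathbb{R}_{\max}$ not both $0_o$, $\ell(F)=1$ if $F=b\odot f_0$ or $F=b\odot f_1$ for some $b\in\mathbb{R}$, and $\ell(F)=2$ otherwise. The degree of degeneracy $\mathrm{ddg}(Q)$ of a collection $Q$ of such $F$ is the number of elements $F$ of $Q$ with $\ell(F)<2$ (here the elements are indexed by $j=3,\dots,q$). Fix $c\in\mathbb{R}\setminus\{0\}$. $C_o(g_0,g_1)(x)=\max\{g_0(x)+g_1(x+c),\;g_0(x+c)+g_1(x)\}$. The statement involves $P_1,P_2$ and so presupposes $q\ge2$. A set $E$ has zero upper density measure if $\limsup_{r\to\infty}\frac1r\int_{E\cap[1,r]}dt=0$. *)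

(* Defs.v *)
From mathcomp Require Import all_boot all_order all_algebra.
From mathcomp Require Import all_classical all_reals all_analysis.
Import Order.TTheory GRing.Theory Num.Theory.
Import numFieldNormedType.Exports.

Set Implicit Arguments.
Unset Strict Implicit.
Unset Printing Implicit Defensive.

Local Open Scope classical_set_scope.
Local Open Scope ring_scope.

Section TropicalProjectiveLine.
Variable R : realType.

(* R_max is \bar R without +oo: there maxe is the tropical sum, adde the
   tropical product, -oo the tropical zero 0_o and 0 the tropical unit 1_o. *)
Definition Rmax : set (\bar R) := [set x | x != +oo%E].

(* Homogeneous coordinates [a1 : a0] of a point of TP^1, which corresponds to
   a0 - a1 in R \cup {-oo, +oo}: the FIRST coordinate is the "denominator". *)
Record tcoord := TCoord { co1 : \bar R; co0 : \bar R }.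

Definition is_TP1 (a : tcoord) : Prop :=
  [/\ Rmax (co1 a), Rmax (co0 a) & ~ (co1 a = -oo%E /\ co0 a = -oo%E)].

Definition TP1_eq (a b : tcoord) : Prop :=
  exists mu : R, co1 b = (mu%:E + co1 a)%E /\ co0 b = (mu%:E + co0 a)%E.

(* (a0 (.) x0) (+) (a1 (.) x1); the argument of fine is finite if is_TP1 a. *)
Definition tpoly (a : tcoord) (x0 x1 : R) : R :=
  fine (maxe (co0 a + x0%:E)%E (co1 a + x1%:E)%E).

End TropicalProjectiveLine.

Section TropicalMeromorphic.
Variable R : realType.
Implicit Types (f g h F : R -> R) (r x c : R).

(* The breakpoints lie in a locally finite set D, possibly infinite, and f is
   affine on every bounded open interval that does not meet D. *)
Definition piecewise_linear f : Prop :=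
  exists D : set R,
    (forall u v : R, finite_set (D `&` `[u, v])) /\
    (forall u v : R, (forall x, u < x < v -> ~ D x) ->
       exists m k : R, forall x, u < x < v -> f x = m * x + k).

Definition tropical_meromorphic f : Prop :=
  continuous f /\ piecewise_linear f.

Definition omega f x : R :=
  lim ((fun e : R => derive1 f (x + e) - derive1 f (x - e)) @ 0^'+).

Definition tzero f x : Prop := 0 < omega f x.

Definition tpole f x : Prop := omega f x < 0.

Definition tropical_entire f : Prop :=
  tropical_meromorphic f /\ (forall x, ~ tpole f x).

Definition pole_count (r : R) f : R :=
  \sum_(x \in [set x | - r < x < r /\ tpole f x]) (- omega f x).

Definition Ncount (r : R) f : R :=
  2^-1 * \int[lebesgue_measure]_(t in `[0, r]) pole_count t f.

(* f = [f0 : f1] *)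
Definition tropical_quotient f f0 f1 : Prop :=
  [/\ tropical_entire f0, tropical_entire f1,
      forall x, ~ (tzero f0 x /\ tzero f1 x)
    & forall x, f x = f1 x - f0 x].

Definition tnorm f0 f1 x : R := Num.max (f0 x) (f1 x).

Definition Tchar f0 f1 r : R :=
  2^-1 * (tnorm f0 f1 r + tnorm f0 f1 (- r)) - tnorm f0 f1 0.

Definition tcomp (a : tcoord R) f0 f1 : R -> R :=
  fun x => tpoly a (f0 x) (f1 x).

Definition ell f0 f1 F : nat :=
  if `[< exists b : R, (forall x, F x = b + f0 x) \/ (forall x, F x = b + f1 x) >]
  then 1 else 2.

(* A family of functions is a list, so repeated members are all counted. *)
Definition ddg f0 f1 (Q : seq (R -> R)) : nat :=
  count (fun F => (ell f0 f1 F < 2)%N) Q.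

Definition tcasorati c g0 g1 : R -> R :=
  fun x => Num.max (g0 x + g1 (x + c)) (g0 (x + c) + g1 x).

Definition zero_upper_density (E : set R) : Prop :=
  measurable E /\
  limf_esup
    (fun r : R => (r^-1)%:E * lebesgue_measure (E `&` `[1%R, r]%classic))%E
    (+oo)%R = 0%E.

(* r tends to infinity outside the exceptional set E *)
Definition oo_off (E : set R) : filter_on R :=
  FilterType (within (~` E) (+oo)%R) (within_filter _ _).

End TropicalMeromorphic.

(* Main.v *)
Require Import Defs.
From mathcomp Require Import all_boot all_order all_algebra.
From mathcomp Require Import all_classical all_reals all_analysis.
From mathcomp Require Import measurable_realfun.
From mathcomp Require Import zify ring lra.
Import Order.TTheory GRing.Theory Num.Theory.
Import numFieldNormedType.Exports.
Set Implicit Arguments.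
Unset Strict Implicit.
Unset Printing Implicit Defensive.
Local Open Scope classical_set_scope.
Local Open Scope ring_scope.

(* For a convex piecewise linear h, Jensen's formula reads
   N(r, -h) = (h(r) + h(-r)) / 2 - h(0) =: J_h(r), and T_f = J_h for
   h = max(f_0, f_1).  As the P_j o f and the Casoratian are convex and piecewise
   linear too, every counting function of the theorem is such a J.
   Comparing P_j o f with max(f_0, f_1) up to constants gives
   0 <= J_{P_j o f} <= T_f + O(1), and T_f <= J_{P_j o f} + O(1) unless
   ell (P_j o f) = 1; T_f grows at least linearly since f is not constant, so
   O(1) = o(T_f).  Finally J_{P_1 o f} + J_{P_2 o f} - J_{C_o} is bounded by
   increments over distance |c| of J_{P_1 o f} and J_{P_2 o f}; with G =
   1 + T_f + J_{P_1 o f} + J_{P_2 o f} = O(T_f), subexponential growth makes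
   ln G(r + |c|) - ln G(r) small off a set of density zero. *)

(** * Convex functions and their symmetric means *)

Section Convexity.
Variable R : realType.
Implicit Types (g h : R -> R) (a b c r s x y : R).

(** Clearing the denominator [b - a] admits degenerate chords and keeps later arguments within
    linear arithmetic. *)
Definition chord_convex h := forall a x b, a <= x -> x <= b ->
  (b - a) * h x <= (b - x) * h a + (x - a) * h b.

Lemma chord_convexD g h :
  chord_convex g -> chord_convex h -> chord_convex (g \+ h).
Proof.
move=> cg ch a x b ax xb /=.
by have := cg a x b ax xb; have := ch a x b ax xb; lra.
Qed.

Lemma chord_convex_cst k : chord_convex (fun=> k).
Proof. by move=> a x b ax xb; lra. Qed.

Lemma chord_convex_shift c h : chord_convex h -> chord_convex (fun x => h (x + c)).
Proof.
move=> ch a x b ax xb.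
have := ch (a + c) (x + c) (b + c); rewrite !lerD2r => /(_ ax xb).
have -> : b + c - (a + c) = b - a by ring.
have -> : b + c - (x + c) = b - x by ring.
by have -> : x + c - (a + c) = x - a by ring.
Qed.

Lemma chord_convex_reflect h : chord_convex h -> chord_convex (fun x => h (- x)).
Proof.
move=> ch a x b ax xb.
by have := ch (- b) (- x) (- a); rewrite !lerN2 => /(_ xb ax); lra.
Qed.

Lemma chord_convex_max g h : chord_convex g -> chord_convex h ->
  chord_convex (fun x => Num.max (g x) (h x)).
Proof.
move=> cg ch a x b ax xb /=.
have [ba bx xa] : [/\ 0 <= b - a, 0 <= b - x & 0 <= x - a] by split; lra.
rewrite maxr_pMr// ge_max; apply/andP; split.
- apply: le_trans (cg a x b ax xb) _.
  by apply: lerD; apply: ler_wpM2l => //; rewrite le_max lexx.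
- apply: le_trans (ch a x b ax xb) _.
  by apply: lerD; apply: ler_wpM2l => //; rewrite le_max lexx orbT.
Qed.

(** The points [a + s] and [b] have the same sum as the endpoints of [[a, b + s]]: add their two
    chord inequalities and cancel the length. *)
Lemma chord_convex_increment h a b s : chord_convex h -> a <= b -> 0 <= s ->
  h (a + s) - h a <= h (b + s) - h b.
Proof.
move=> ch ab s0.
have [->|ab'] := eqVneq a b; first by [].
have ltab : a < b by rewrite lt_neqAle ab'.
have p : 0 < b + s - a by lra.
have h1 := ch a (a + s) (b + s) ltac:(lra) ltac:(lra).
have h2 := ch a b (b + s) ab ltac:(lra).
rewrite -subr_ge0 -(pmulr_rge0 _ p); lra.
Qed.

(** A rise from [x] to [y] would persist to the right and overtake any upper bound. *)
Lemma chord_convex_ub_nonincreasing h k x y : chord_convex h ->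
  (forall x, h x <= k) -> x <= y -> h y <= h x.
Proof.
move=> ch hk xy; rewrite leNgt; apply/negP => hxy.
have xy' : x < y by rewrite lt_neqAle xy andbT; apply/eqP => e; rewrite e ltxx in hxy.
(* At parameter [t] the line through the two points of the graph reaches height [k + 1]. *)
pose t := (k - h x + 1) / (h y - h x).
have d0 : 0 < h y - h x by lra.
have tE : t * (h y - h x) = k - h x + 1 by rewrite /t divfK// gt_eqF.
have t1 : 1 <= t by rewrite /t ler_pdivlMr// mul1r; have := hk y; lra.
have := ch x y (x + t * (y - x)) xy.
have yb : y <= x + t * (y - x) by nra.
move=> /(_ yb); have := hk (x + t * (y - x)).
set z := h (x + _) => hz.
have : (y - x) * (t * (h y - h x)) = (y - x) * (k - h x + 1) by rewrite tE.
have : (y - x) * z <= (y - x) * k by rewrite ler_wpM2l//; lra.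
nra.
Qed.

Lemma chord_convex_ub_cst h k x y : chord_convex h ->
  (forall x, h x <= k) -> h x = h y.
Proof.
move=> ch hk; wlog xy : x y / x <= y.
  by move=> H; have [/H//|/ltW /H ->] := leP x y.
apply/eqP; rewrite eq_le (chord_convex_ub_nonincreasing ch hk xy) andbT.
have := chord_convex_ub_nonincreasing (chord_convex_reflect ch)
  (fun x => hk (- x)) (x := - y) (y := - x).
by rewrite !opprK; apply; rewrite lerN2.
Qed.

(* By Jensen's formula [jensen h r] is the counting function of the zeros of a
   tropical entire [h]; [Tchar f0 f1] is [jensen (tnorm f0 f1)]. *)
Definition jensen h r := 2^-1 * (h r + h (- r)) - h 0.

Lemma jensen0 h : jensen h 0 = 0.
Proof. by rewrite /jensen oppr0; field. Qed.

Lemma jensen_ge0 h r : chord_convex h -> 0 <= r -> 0 <= jensen h r.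
Proof.
move=> ch r0; have [->|rn0] := eqVneq r 0; first by rewrite jensen0.
have rp : 0 < r by rewrite lt_neqAle eq_sym rn0.
have := ch (- r) 0 r ltac:(lra) ltac:(lra); rewrite /jensen => H.
rewrite -(pmulr_rge0 _ rp); lra.
Qed.

(** The increment of [h] over [[r, s]] dominates the one over [[- s, - r]]. *)
Lemma jensen_homo h r s : chord_convex h -> 0 <= r -> r <= s ->
  jensen h r <= jensen h s.
Proof.
move=> ch r0 rs; have := chord_convex_increment (s := s - r) (a := - s) (b := r) ch.
have -> : - s + (s - r) = - r by ring.
have -> : r + (s - r) = s by ring.
by rewrite /jensen => /(_ ltac:(lra) ltac:(lra)); lra.
Qed.

Lemma chord_convex_jensen h : chord_convex h -> chord_convex (jensen h).
Proof.
move=> ch; have cr := chord_convex_reflect ch => a x b ax xb.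
have := ch a x b ax xb; have := cr a x b ax xb; rewrite /jensen; lra.
Qed.

(* The increments of [h] at [r] and at [- r] are bounded below by those at [0],
   and they add up to twice the increment of [jensen h]. *)
Lemma chord_convex_shift_bound h r s t : chord_convex h -> 0 <= r -> 0 <= s ->
  `|t| = s ->
  `|h (r + t) - h r| <= 2 * (jensen h (r + s) - jensen h r)
     + (`|h s - h 0| + `|h (- s) - h 0|).
Proof.
move=> ch r0 s0 ts.
have i1 := chord_convex_increment ch r0 s0; rewrite add0r in i1.
have i2 := chord_convex_increment (a := - r - s) (b := - s) ch ltac:(lra) s0.
rewrite subrK addNr in i2.
have n1 := ler_norm (h s - h 0); have n1' := ler_norm (- (h s - h 0)).
have n2 := ler_norm (h (- s) - h 0); have n2' := ler_norm (- (h (- s) - h 0)).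
rewrite !normrN in n1' n2'.
have J : jensen h (r + s) - jensen h r =
  2^-1 * (h (r + s) - h r + (h (- r - s) - h (- r))).
  by rewrite /jensen opprD; ring.
have Jge : 0 <= jensen h (r + s) - jensen h r.
  by rewrite subr_ge0; apply: jensen_homo => //; lra.
have [t0|t0] := leP 0 t.
  have -> : t = s by rewrite -ts ger0_norm.
  rewrite ler_norml; apply/andP; split; lra.
have -> : t = - s by rewrite -ts ltr0_norm ?opprK.
have i3 := chord_convex_increment (a := - s) (b := r - s) ch ltac:(lra) s0.
rewrite subrK addNr in i3.
have i4 := chord_convex_increment (a := r - s) (b := r) ch ltac:(lra) s0.
rewrite subrK in i4.
rewrite ler_norml; apply/andP; split; lra.
Qed.

Lemma jensen_reflect h r : jensen (fun x => h (- x)) r = jensen h r.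
Proof. by rewrite /jensen opprK oppr0 [h (- r) + _]addrC. Qed.

(** A vanishing mean makes [- h] a reflection of [h] up to a constant, hence convex. *)
Lemma jensen_eq0_concave h : chord_convex h ->
  (forall r, 0 <= r -> jensen h r = 0) -> chord_convex (fun x => - h x).
Proof.
move=> ch j0; suff H x : - h x = h (- x) - 2 * h 0.
  move=> a x b ax xb; rewrite !H.
  by have := chord_convex_reflect ch ax xb; lra.
wlog x0 : x / 0 <= x.
  move=> H; have [/H//|/ltW x0] := leP 0 x.
  by have := H (- x); rewrite opprK oppr_ge0 => /(_ x0); lra.
by have := j0 x x0; rewrite /jensen; lra.
Qed.

(** If [jensen] of the maximum is nonzero somewhere, its convexity and its zero at [0] force linear
    growth. Otherwise the maximum is convex and concave, so [g] and [h] minus it are convex and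
    bounded above, hence constant, and so is [h - g]. *)
Lemma jensen_max_unbounded g h : chord_convex g -> chord_convex h ->
  ~ (exists k, forall x, h x - g x = k) ->
  forall M, exists r0, forall r, r0 <= r ->
    M <= jensen (fun x => Num.max (g x) (h x)) r.
Proof.
move=> cg ch ncst M; pose u x := Num.max (g x) (h x).
have cu : chord_convex u by exact: chord_convex_max.
have gu x : g x <= u x by rewrite /u le_max lexx.
have hu x : h x <= u x by rewrite /u le_max lexx orbT.
have [[r1 [r10 j1]]|nj] := pselect (exists r, 0 <= r /\ jensen u r != 0).
  have r1p : 0 < r1.
    rewrite lt_neqAle r10 andbT; apply/eqP => e; move: j1.
    by rewrite -e jensen0 eqxx.
  have j1p : 0 < jensen u r1 by rewrite lt_neqAle eq_sym j1 jensen_ge0.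
  exists (Num.max r1 (M * r1 / jensen u r1)) => r; rewrite -/u ge_max => /andP[r1r].
  rewrite ler_pdivrMr// => Mr.
  have := chord_convex_jensen cu r10 r1r; rewrite jensen0 => H.
  by rewrite -(ler_pM2l r1p); lra.
have cNu : chord_convex (fun x => - u x).
  apply: jensen_eq0_concave => // r r0.
  by apply/eqP/negPn/negP => jr; apply: nj; exists r.
have gu0 x : (g \+ (fun x => - u x)) x <= 0 by rewrite subr_le0.
have hu0 x : (h \+ (fun x => - u x)) x <= 0 by rewrite subr_le0.
case: ncst; exists (h 0 - g 0) => x.
have := chord_convex_ub_cst x 0 (chord_convexD cg cNu) gu0.
have := chord_convex_ub_cst x 0 (chord_convexD ch cNu) hu0.
by rewrite /=; lra.
Qed.

End Convexity.

(** * Piecewise affine functions *)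

Section PiecewiseAffine.
Variable R : realType.
Implicit Types (g h l rho : R -> R) (a b c e m r s x y : R).

(** Supremum argument: if the points reachable from [a] stopped at [s < b], the local hypothesis at
    [s] would carry them further. *)
Lemma interval_additive (P : R -> R -> Prop) :
  (forall a b c, a < b -> b < c -> P a b -> P b c -> P a c) ->
  (forall x, exists2 e, 0 < e &
    (forall a b, x - e <= a -> a < b -> b <= x -> P a b) /\
    (forall a b, x <= a -> a < b -> b <= x + e -> P a b)) ->
  forall a b, a < b -> P a b.
Proof.
move=> Padd Ploc a b ab.
pose S := [set t | a < t <= b /\ P a t].
have [ea ea0 [_ Pa]] := Ploc a.
have Sa : S (Num.min b (a + ea)).
  have lta : a < Num.min b (a + ea) by rewrite lt_min ab ltrDl.
  by split; [rewrite lta ge_min lexx|apply: Pa => //; rewrite ge_min lexx orbT].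
have ubS : ubound S b by move=> t [/andP[_ ->]].
have hS : has_sup S by split; [exists (Num.min b (a + ea))|exists b].
have hub : has_ubound S by exists b.
set s := sup S.
have as_ : a < s.
  apply: lt_le_trans (ub_le_sup hub Sa).
  by rewrite lt_min ab ltrDl.
have sb : s <= b by apply: ge_sup => //; exists (Num.min b (a + ea)).
have [e e0 [Pl Pr]] := Ploc s.
have Ps : P a s.
  have [t [/andP[at_ tb] Pt] st] := sup_adherent e0 hS.
  have ts : t <= s by apply: (ub_le_sup hub); split=> //; rewrite at_.
  have [<-//|nts] := eqVneq t s.
  have tls : t < s by rewrite lt_neqAle nts.
  by apply: Padd Pt _ => //; apply: Pl => //; apply: ltW.
have [<-//|nsb] := eqVneq s b.
have slb : s < b by rewrite lt_neqAle nsb.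
have sm : s < Num.min b (s + e) by rewrite lt_min slb ltrDl.
suff /(ub_le_sup hub) : S (Num.min b (s + e)).
  by rewrite -/s leNgt sm.
split; first by rewrite (lt_trans as_ sm) ge_min lexx.
by apply: Padd Ps _ => //; apply: Pr => //; rewrite ge_min lexx orbT.
Qed.

Definition affine_germ h x e ml mr :=
  (forall y, x - e <= y -> y <= x -> h y = h x + ml * (y - x)) /\
  (forall y, x <= y -> y <= x + e -> h y = h x + mr * (y - x)).

(** [l] and [rho] are the one-sided derivatives. Germs stand in for a global set of breakpoints
    because they pass easily to sums, shifts and maxima. *)
Definition pl_slopes h l rho :=
  forall x, exists2 e, 0 < e & affine_germ h x e (l x) (rho x).

Lemma affine_germ_le h x e e' ml mr : e' <= e ->
  affine_germ h x e ml mr -> affine_germ h x e' ml mr.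
Proof. by move=> ee [L M]; split=> y xy yx; [apply: L|apply: M]; lra. Qed.

Lemma pl_slopes_exists h :
  (forall x, exists e ml mr, 0 < e /\ affine_germ h x e ml mr) ->
  exists l rho, pl_slopes h l rho.
Proof.
move=> H; have /choice[p pP] : forall x, exists p : R * R,
    exists2 e, 0 < e & affine_germ h x e p.1 p.2.
  by move=> x; have [e [ml [mr [e0 A]]]] := H x; exists (ml, mr), e.
by exists (fun x => (p x).1), (fun x => (p x).2).
Qed.

Lemma pl_slopesD g h l rho l' rho' : pl_slopes g l rho -> pl_slopes h l' rho' ->
  pl_slopes (g \+ h) (l \+ l') (rho \+ rho').
Proof.
move=> sg sh x; have [e e0 G] := sg x; have [e' e0' H] := sh x.
exists (Num.min e e'); first by rewrite lt_min e0.
have [G1 G2] : affine_germ g x (Num.min e e') (l x) (rho x).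
  by apply: affine_germ_le G; rewrite ge_min lexx.
have [H1 H2] : affine_germ h x (Num.min e e') (l' x) (rho' x).
  by apply: affine_germ_le H; rewrite ge_min lexx orbT.
by split=> y xy yx /=; [rewrite G1// H1//|rewrite G2// H2//]; ring.
Qed.

Lemma pl_slopes_cst k : pl_slopes (fun=> k) (fun=> 0) (fun=> 0).
Proof. by move=> x; exists 1 => //; split=> y _ _; ring. Qed.

Lemma pl_slopesN h l rho : pl_slopes h l rho -> pl_slopes (\- h) (\- l) (\- rho).
Proof.
move=> sh x; have [e e0 [L M]] := sh x; exists e => //.
by split=> y xy yx /=; [rewrite L//|rewrite M//]; ring.
Qed.

Lemma pl_slopes_shift c h l rho : pl_slopes h l rho ->
  pl_slopes (fun x => h (x + c)) (fun x => l (x + c)) (fun x => rho (x + c)).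
Proof.
move=> sh x; have [e e0 [L M]] := sh (x + c); exists e => //.
by split=> y xy yx /=; [rewrite L; [|lra|lra]|rewrite M; [|lra|lra]]; ring.
Qed.

Lemma pl_slopes_reflect h l rho : pl_slopes h l rho ->
  pl_slopes (fun x => h (- x)) (fun x => - rho (- x)) (fun x => - l (- x)).
Proof.
move=> sh x; have [e e0 [L M]] := sh (- x); exists e => //.
by split=> y xy yx /=; [rewrite M; [|lra|lra]|rewrite L; [|lra|lra]]; ring.
Qed.

Lemma affine_germ_pos h x e ml mr : 0 < e -> affine_germ h x e ml mr ->
  0 < h x -> exists2 e', 0 < e' <= e & forall y, x - e' <= y <= x + e' -> 0 < h y.
Proof.
move=> e0 [L M] hx.
pose k := `|ml| + `|mr| + 1.
have k0 : 0 < k by rewrite /k ltr_pwDr// addr_ge0.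
pose e' := Num.min e (h x / (2 * k)).
have e'e : e' <= e by rewrite /e' ge_min lexx.
have ke : k * e' <= h x / 2.
  have : e' <= h x / (2 * k) by rewrite /e' ge_min lexx orbT.
  by rewrite ler_pdivlMr ?mulr_gt0//; lra.
have e'0 : 0 < e' by rewrite /e' lt_min e0 divr_gt0// mulr_gt0.
exists e'; first by rewrite e'0.
move=> y /andP[y1 y2].
have small m : `|m| <= k -> 0 < h x + m * (y - x).
  move=> mk; have : `|m * (y - x)| <= k * e'.
    by rewrite normrM ler_pM// ler_norml; apply/andP; split; lra.
  by rewrite ler_norml => /andP[? _]; lra.
have [yx|xy] := leP y x.
  by rewrite L//; [apply: small; rewrite /k -addrA lerDl addr_ge0|lra].
rewrite M ?(ltW xy)//; last lra.
by apply: small; rewrite /k addrAC lerDr addr_ge0.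
Qed.

(** Where the values differ, the larger function is the maximum nearby; at a tie the one-sided
    slopes decide. *)
Lemma pl_slopes_max g h l rho l' rho' :
  pl_slopes g l rho -> pl_slopes h l' rho' ->
  exists l0 rho0, pl_slopes (fun x => Num.max (g x) (h x)) l0 rho0.
Proof.
move=> sg sh; apply: pl_slopes_exists => x.
have dominated g' h' lg rg lh rh : pl_slopes g' lg rg -> pl_slopes h' lh rh ->
    h' x < g' x -> exists e ml mr, 0 < e /\
    affine_germ (fun x => Num.max (g' x) (h' x)) x e ml mr.
  move=> sg' sh' hg; have [e e0 D] := pl_slopesD sg' (pl_slopesN sh') x.
  have [|e' /andP[e'0 e'e] pos] := affine_germ_pos e0 D; first by rewrite subr_gt0.
  have [e1 e10 G] := sg' x.
  exists (Num.min e' e1), (lg x), (rg x); split; first by rewrite lt_min e'0.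
  have [G1 G2] : affine_germ g' x (Num.min e' e1) (lg x) (rg x).
    by apply: affine_germ_le G; rewrite ge_min lexx orbT.
  have mE y : x - Num.min e' e1 <= y <= x + Num.min e' e1 ->
      Num.max (g' y) (h' y) = g' y.
    have : Num.min e' e1 <= e' by rewrite ge_min lexx.
    move=> me' /andP[y1 y2]; apply/max_idPl/ltW.
    by rewrite -subr_gt0; apply: pos; apply/andP; split; lra.
  have m0 : 0 <= Num.min e' e1 by rewrite le_min !ltW.
  have mx : Num.max (g' x) (h' x) = g' x by apply/max_idPl/ltW.
  split=> y xy yx; rewrite mx mE; [exact: G1| |exact: G2|].
    by apply/andP; split; lra.
  by apply/andP; split; lra.
have [hg|gh|ghE] := ltgtP (h x) (g x).
- exact: dominated sg sh hg.
- have -> : (fun x => Num.max (g x) (h x)) = (fun x => Num.max (h x) (g x)).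
    by apply/funext => y; rewrite maxC.
  exact: dominated sh sg gh.
have [e e0 G] := sg x; have [e' e0' H] := sh x.
(* To the left [y - x] is nonpositive, so the larger value there belongs to the smaller slope. *)
exists (Num.min e e'), (Num.min (l x) (l' x)), (Num.max (rho x) (rho' x)).
split; first by rewrite lt_min e0.
have [G1 G2] : affine_germ g x (Num.min e e') (l x) (rho x).
  by apply: affine_germ_le G; rewrite ge_min lexx.
have [H1 H2] : affine_germ h x (Num.min e e') (l' x) (rho' x).
  by apply: affine_germ_le H; rewrite ge_min lexx orbT.
split=> y xy yx.
  rewrite G1// H1// ghE maxxx -addr_maxr minr_nMl ?subr_le0//.
rewrite G2// H2// ghE maxxx -addr_maxr maxr_pMl ?subr_ge0//.
Qed.

Lemma derive1_affine_on h a b m k y : (forall z, a < z < b -> h z = m * z + k) ->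
  a < y < b -> derive1 h y = m.
Proof.
move=> H yab; rewrite derive1E (@near_eq_derive _ _ _ _ (fun z => m * z + k)).
  by rewrite derive_val /GRing.scale /= mulr1 addr0.
have yI : y \in `]a, b[ by rewrite in_itv.
by apply: filterS (near_in_itvoo yI) => z; rewrite in_itv /= => /H.
Qed.

(** For small [d] the points [x + d] and [x - d] lie inside the two affine germs, so the function
    under the limit is eventually constant. *)
Lemma omegaE h l rho x : pl_slopes h l rho -> omega h x = rho x - l x.
Proof.
move=> sh; have [e e0 [L M]] := sh x.
rewrite /omega; apply/cvg_lim => //.
apply: (@cvg_trans _ ((fun=> rho x - l x) @ 0^'+)); last exact: cvg_cst.
apply: near_eq_cvg; near=> d.
have d0 : 0 < d by near: d; exact: nbhs_right_gt.
have de : d < e by near: d; exact: nbhs_right_lt.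
rewrite (@derive1_affine_on h x (x + e) (rho x) (h x - rho x * x)).
- rewrite (@derive1_affine_on h (x - e) x (l x) (h x - l x * x))//.
  + by move=> z /andP[z1 z2]; rewrite L ?ltW//; ring.
  + by apply/andP; split; lra.
- by move=> z /andP[z1 z2]; rewrite M ?ltW//; ring.
- by apply/andP; split; lra.
Unshelve. all: by end_near. Qed.

End PiecewiseAffine.

(** * Jensen's formula *)

Lemma integrable_setU d (T : measurableType d) (R : realType)
    (nu : {measure set T -> \bar R}) (A B : set T) (f : T -> \bar R) :
  measurable A -> measurable B -> [disjoint A & B] ->
  nu.-integrable A f -> nu.-integrable B f -> nu.-integrable (A `|` B) f.
Proof.
move=> mA mB AB /integrableP[mAf iAf] /integrableP[mBf iBf].
have mf := (measurable_funU f mA mB).2 (conj mAf mBf).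
apply/integrableP; split => //.
rewrite ge0_integral_setU//; first by rewrite lte_add_pinfty.
exact: measurableT_comp.
Qed.

Section Jensen.
Variable R : realType.
Implicit Types (g h l rho : R -> R) (a b c e m r s x y : R).

Lemma continuous_affine_left h x e m k : {for x, continuous h} -> 0 < e ->
  (forall y, x - e < y < x -> h y = m * y + k) -> h x = m * x + k.
Proof.
move=> ch e0 H; apply: (@cvg_unique _ _ (h @ x^'-)).
- exact: norm_hausdorff.
- exact: cvg_at_left_filter.
apply: (@cvg_trans _ ((fun y => m * y + k) @ x^'-)).
  apply: near_eq_cvg; near=> y; rewrite H//; apply/andP; split.
    by near: y; apply: nbhs_left_gt; lra.
  by near: y; exact: nbhs_left_lt.
apply: cvg_at_left_filter; apply: cvgD; last exact: cvg_cst.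
by apply: cvgM; [exact: cvg_cst|exact: cvg_id].
Unshelve. all: by end_near. Qed.

(** Finitely many breakpoints near [x] form a closed set, so those other than [x] can be avoided;
    then [h] is affine on each side, and continuity gives both pieces the value [h x]. *)
Lemma tropical_meromorphic_pl_slopes h : tropical_meromorphic h ->
  exists l rho, pl_slopes h l rho.
Proof.
move=> [ch [D [Dfin Daff]]]; apply: pl_slopes_exists => x.
have : nbhs x (~` ((D `&` `[x - 1, x + 1]) `\ x)).
  apply: open_nbhs_nbhs; split.
    apply: closed_openC.
    have /accessible_finite_set_closed closed_fin :=
      hausdorff_accessible (@norm_hausdorff R R).
    by apply: closed_fin; apply: finite_setD; exact: Dfin.
  by move=> [_] /(_ erefl).
move=> /nbhs_ballP[e0 /= e00 De0].
pose e := Num.min e0 1.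
have e0' : 0 < e by rewrite lt_min e00 ltr01.
have ee0 : e <= e0 by rewrite ge_min lexx.
have e1 : e <= 1 by rewrite ge_min lexx orbT.
have nD y : y != x -> x - e < y < x + e -> ~ D y.
  move=> yx /andP[y1 y2] Dy; apply: (De0 y).
    by rewrite /ball /= ltr_norml; apply/andP; split; lra.
  split; last exact/eqP.
  by split => //; rewrite /= in_itv /=; apply/andP; split; lra.
have [|ml [kl hl]] := Daff (x - e) x.
  by move=> y /andP[y1 y2]; apply: nD; [rewrite lt_eqF|apply/andP; split; lra].
have [|mr [kr hr]] := Daff x (x + e).
  by move=> y /andP[y1 y2]; apply: nD; [rewrite gt_eqF|apply/andP; split; lra].
have hxl : h x = ml * x + kl by apply: continuous_affine_left e0' _ => //; exact: ch.
have hxr : h x = mr * x + kr.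
  (* Reflection turns the right-hand piece into a left-hand one. *)
  have := @continuous_affine_left (fun y => h (- y)) (- x) e (- mr) kr.
  rewrite opprK mulrNN; apply=> //.
    by apply: continuous_comp; [exact: opp_continuous|exact: ch].
  by move=> y /andP[y1 y2]; rewrite hr; [ring|apply/andP; split; lra].
(* Halving keeps the closed intervals of the germ inside the open ones where [hl] and [hr] hold. *)
exists (e / 2), ml, mr; split; first by rewrite divr_gt0.
split=> y y1 y2.
  have [->|yx] := eqVneq y x; first by rewrite subrr mulr0 addr0.
  rewrite hl; first by rewrite hxl; ring.
  by have := lt_neqAle y x; rewrite yx y2 /= => ->; rewrite andbT; lra.
have [->|yx] := eqVneq y x; first by rewrite subrr mulr0 addr0.
rewrite hr; first by rewrite hxr; ring.
by have := lt_neqAle x y; rewrite eq_sym yx y1 /= => ->; lra.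
Qed.

(** The chord over [[x - e, x + e]] gives [0 <= e ^+ 2 * (rho x - l x)]. *)
Lemma chord_convex_slopes h l rho x : pl_slopes h l rho -> chord_convex h ->
  l x <= rho x.
Proof.
move=> sh ch; have [e e0 [L M]] := sh x.
have := ch (x - e) x (x + e) ltac:(lra) ltac:(lra).
rewrite (L (x - e)) ?(M (x + e)); [|lra|lra|lra|lra] => H.
rewrite -(ler_pM2l (mulr_gt0 e0 e0)); lra.
Qed.

Lemma pl_slopes_affine h l rho a b m k : pl_slopes h l rho -> a < b ->
  (forall y, a <= y <= b -> h y = m * y + k) -> rho a = m /\ l b = m.
Proof.
move=> sh ab A.
have [ea ea0 [_ Ma]] := sh a; have [eb eb0 [Lb _]] := sh b.
pose d := Num.min (b - a) (Num.min ea eb).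
have d0 : 0 < d by rewrite !lt_min ea0 eb0 subr_gt0 ab.
have [d1 d2 d3] : [/\ d <= b - a, d <= ea & d <= eb].
  by split; rewrite !ge_min lexx ?orbT.
split.
  have := Ma (a + d) ltac:(lra) ltac:(lra).
  rewrite !A; [|apply/andP; split; lra|apply/andP; split; lra].
  by move=> E; apply: (mulIf (lt0r_neq0 d0)); lra.
have := Lb (b - d) ltac:(lra) ltac:(lra).
rewrite !A; [|apply/andP; split; lra|apply/andP; split; lra].
by move=> E; apply: (mulIf (lt0r_neq0 d0)); lra.
Qed.

(** Induction over affine pieces: each germ supplies one on either side of its centre, and
    [interval_additive] glues them. *)
Lemma pl_slopes_ind h l rho (P : R -> R -> Prop) : pl_slopes h l rho ->
  (forall a b c, a < b -> b < c -> P a b -> P b c -> P a c) ->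
  (forall a b m k, a < b -> (forall y, a <= y <= b -> h y = m * y + k) -> P a b) ->
  forall a b, a < b -> P a b.
Proof.
move=> sh Padd Paff; apply: interval_additive => // x.
have [e e0 [L M]] := sh x; exists e => //; split=> a b xa ab bx.
  by apply: (Paff _ _ (l x) (h x - l x * x)) => // y /andP[? ?]; rewrite L; lra.
by apply: (Paff _ _ (rho x) (h x - rho x * x)) => // y /andP[? ?]; rewrite M; lra.
Qed.

(** That the mean slope over [[a, b]] lies between [rho a] and [l b], with [rho a <= l b], survives
    gluing. At [x] the mean slope on the left is then at most [l x <= rho x], hence at most the one
    on the right. *)
Lemma slopes_chord_convex h l rho : pl_slopes h l rho ->
  (forall x, l x <= rho x) -> chord_convex h.
Proof.
move=> sh lr.
have H : forall a b, a < b ->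
    [/\ rho a <= l b, rho a * (b - a) <= h b - h a & h b - h a <= l b * (b - a)].
  apply: (pl_slopes_ind sh) => [a b c ab bc [r1 r2 r3] [s1 s2 s3]|a b m k ab A].
    have rb := lr b; split; [lra| |].
      have : 0 <= (rho b - rho a) * (c - b) by apply: mulr_ge0; lra.
      lra.
    have : 0 <= (l c - l b) * (b - a) by apply: mulr_ge0; lra.
    lra.
  have [-> ->] := pl_slopes_affine sh ab A.
  by rewrite !A ?lexx ?(ltW ab)//; split; lra.
move=> a x b; rewrite le_eqVlt => /predU1P[->|ax]; first by lra.
rewrite le_eqVlt => /predU1P[->|xb]; first by lra.
have [_ _ h1] := H a x ax; have [_ h2 _] := H x b xb; have lrx := lr x.
have : 0 <= (b - x) * (l x * (x - a) - (h x - h a)) by apply: mulr_ge0; lra.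
have : 0 <= (x - a) * (h b - h x - rho x * (b - x)) by apply: mulr_ge0; lra.
have : 0 <= (rho x - l x) * ((x - a) * (b - x)).
  by apply: mulr_ge0; [|apply: mulr_ge0]; lra.
lra.
Qed.

Lemma tropical_entire_pl_convex h : tropical_entire h ->
  chord_convex h /\ exists l rho, pl_slopes h l rho.
Proof.
move=> [/tropical_meromorphic_pl_slopes[l [rho sh]] np]; split; last by exists l, rho.
apply: (slopes_chord_convex sh) => x; have := np x.
by rewrite /tpole (omegaE _ sh) subr_lt0 => /negP; rewrite -leNgt.
Qed.

(** Gluing two open intervals adds the junction [b], whose jump [rho b - l b] is exactly what the
    two totals lack. *)
Lemma sum_slope_jumps h l rho : pl_slopes h l rho -> (forall x, l x <= rho x) ->
  forall a b, a < b ->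
  finite_set [set x | a < x < b /\ l x < rho x] /\
  \sum_(x \in [set x | a < x < b /\ l x < rho x]) (rho x - l x) = l b - rho a.
Proof.
move=> sh lr; apply: (pl_slopes_ind sh) => [a b c ab bc|a b m k ab A].
  pose A a b := [set x | a < x < b /\ l x < rho x].
  rewrite -/(A a b) -/(A b c) -/(A a c).
  move=> [fab sab] [fbc sbc].
  have AU : A a c = A a b `|` (A b c `|` [set x | x = b /\ l x < rho x]).
    apply/seteqP; split=> x.
      move=> [/andP[ax xc] lx].
      have [xb|bx|xb] := ltgtP x b.
      - by left; split => //; rewrite ax.
      - by right; left; split => //; rewrite bx.
      - by right; right.
    move=> [[/andP[ax xb] lx]|[[/andP[bx xc] lx]|[-> lx]]]; split => //.
    - by rewrite ax (lt_trans xb).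
    - by rewrite xc (lt_trans ab).
    - by rewrite ab.
  have fb : finite_set [set x | x = b /\ l x < rho x].
    by apply: sub_finite_set (finite_set1 b) => x [].
  rewrite AU; split; first by rewrite !finite_setU.
  rewrite fsbigU0//; last 2 first.
    by rewrite finite_setU.
    by move=> x [[/andP[_ xb] _]] [[/andP[bx _] _]|[e _]]; lra.
  rewrite fsbigU0//; last by move=> x [[/andP[bx _] _]] [e _]; lra.
  (* A junction without a jump is absent from the index set, in agreement with its zero
     contribution. *)
  rewrite sab sbc; have := lr b; rewrite le_eqVlt => /predU1P[lb|lb].
    rewrite (_ : [set _ | _] = set0) ?fsbig_set0 /=; first by rewrite lb; ring.
    by apply/seteqP; split => // x [-> ]; rewrite lb ltxx.
  rewrite (_ : [set _ | _] = [set b]) ?fsbig_set1 /=; first by ring.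
  by apply/seteqP; split => [x []//|x ->].
have -> : [set x | a < x < b /\ l x < rho x] = set0.
  apply/seteqP; split => // x [/andP[ax xb]].
  have [_ ->] : rho a = m /\ l x = m.
    apply: (pl_slopes_affine sh ax (k := k)) => y /andP[ay yx].
    by apply: A; rewrite ay (le_trans yx (ltW xb)).
  have [-> _] : rho x = m /\ l b = m.
    apply: (pl_slopes_affine sh xb (k := k)) => y /andP[xy yb].
    by apply: A; rewrite yb (le_trans (ltW ax) xy).
  by rewrite ltxx.
have [-> ->] := pl_slopes_affine sh ab A.
by rewrite fsbig_set0 subrr; split.
Qed.

Local Notation mu := (@lebesgue_measure R).

(** The fundamental theorem of calculus, piece by piece. Half-open intervals are disjoint when
    adjacent, and on an affine one [l] is constant up to and including the right endpoint. *)
Lemma integral_left_slope h l rho : pl_slopes h l rho -> forall a b, a < b ->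
  mu.-integrable `]a, b] (EFin \o l) /\ \int[mu]_(t in `]a, b]) l t = h b - h a.
Proof.
move=> sh; apply: (pl_slopes_ind sh) => [a b c ab bc [iab sab] [ibc sbc]|a b m k ab A].
  have U : `]a, c]%classic = `]a, b]%classic `|` `]b, c]%classic.
    by rewrite -itv_bndbnd_setU// bnd_simp ltW.
  have D : [disjoint `]a, b]%classic & `]b, c]%classic].
    apply/disj_setPS => x [] /=; rewrite !in_itv /= => /andP[_ xb] /andP[bx _].
    by move: bx; rewrite ltNge xb.
  have iac : mu.-integrable `]a, c] (EFin \o l) by rewrite U; exact: integrable_setU.
  split=> //; rewrite U Rintegral_setU//; first by rewrite sab sbc; ring.
    by rewrite -U.
have lm : {in `]a, b]%classic, cst m =1 l}.
  move=> t; rewrite inE /= in_itv /= => /andP[at_ tb].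
  have [_ //] : rho a = m /\ l t = m.
  apply: (pl_slopes_affine sh at_ (k := k)) => y /andP[ay yt].
  by apply: A; rewrite ay (le_trans yt).
have fin : (mu `]a, b] < +oo)%E.
  by rewrite lebesgue_measure_itv /= lte_fin ab ltry.
split.
  apply: (@eq_integrable _ _ _ mu _ _ (EFin \o cst m)) => //.
    by move=> t /lm /= ->.
  apply: measurable_bounded_integrable => //.
  exists `|m|; split=> // x xm t _ /=; exact: ltW.
rewrite (@eq_Rintegral _ _ _ mu _ (cst m)); last by move=> t /lm.
rewrite Rintegral_cst//= lebesgue_measure_itv /= lte_fin ab.
by rewrite !A ?lexx ?(ltW ab)//=; ring.
Qed.

(** The poles of [- h] in []- t, t[] have total multiplicity [l t - rho (- t)], which is the left
    derivative at [t] of [h x + h (- x)]; integrating it gives [2 * jensen h r]. *)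
Lemma Ncount_jensen h l rho r : pl_slopes h l rho -> chord_convex h -> 0 <= r ->
  Ncount r (\- h) = jensen h r.
Proof.
move=> sh ch r0; have lr x := chord_convex_slopes x sh ch.
have oN x : omega (\- h) x = l x - rho x by rewrite (omegaE _ (pl_slopesN sh)) opprK addrC.
have pcE t : 0 < t -> pole_count t (\- h) = l t - rho (- t).
  move=> t0; have [_ <-] := sum_slope_jumps sh lr (a := - t) (b := t) ltac:(lra).
  rewrite /pole_count; under eq_fsbigr do rewrite oN opprB.
  congr (\big[_/_]_(_ \in _) _); apply/seteqP.
  by split=> x; rewrite /= /tpole oN subr_lt0.
have [->|rn0] := eqVneq r 0.
  by rewrite jensen0 /Ncount set_itv1 Rintegral_set1 mulr0.
have rp : 0 < r by rewrite lt_neqAle eq_sym rn0.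
have [ik sk] := integral_left_slope (pl_slopesD sh (pl_slopes_reflect sh)) rp.
have pcE' : {in `]0, r]%classic, l \+ (fun x => - rho (- x)) =1
    (fun t => pole_count t (\- h))}.
  by move=> t; rewrite inE /= in_itv /= => /andP[t0 _]; rewrite pcE.
(* The pole count is known for [t > 0] only, so the endpoint [0] is first removed from the
   domain. *)
rewrite /Ncount -Rintegral_itv_obnd_cbnd; last first.
  by apply: eq_integrable ik => // t /pcE' /= <-.
rewrite (@eq_Rintegral _ _ _ mu _ (l \+ (fun x => - rho (- x)))); last first.
  by move=> t /pcE'.
by rewrite sk /jensen /= oppr0; lra.
Qed.

End Jensen.

(** * Growth off a set of density zero *)

Section Growth.
Variable R : realType.
Implicit Types (r s e : R).

(** Tail suprema make the majorant nonincreasing and a harmonic term makes it positive. After the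
    square root, [v] can serve in Markov's inequality both as threshold and as bound on the
    frequency. *)
Lemma vanishing_square_majorant (u : nat -> R) : (forall n, 0 <= u n) ->
  (forall e, 0 < e -> exists N, forall n, (N <= n)%N -> u n <= e) ->
  exists v : nat -> R, [/\ forall n, 0 < v n,
    forall m n, (m <= n)%N -> v n <= v m,
    forall n, u n <= v n ^+ 2
    & forall e, 0 < e -> exists N, forall n, (N <= n)%N -> v n <= e].
Proof.
move=> u0 ulim.
have cu : u @ \oo --> (0 : R).
  apply/cvgrPdist_le => e e0; have [N uN] := ulim e e0.
  by exists N => // n /= Nn; rewrite sub0r normrN ger0_norm//; exact: uN.
have hub : has_ubound (range u).
  exact/bounded_fun_has_ubound/cvg_seq_bounded/(cvgP _ cu).
have su n : u n <= sups u n.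
  apply: ub_le_sup; last by exists n => /=.
  by apply: subset_has_ubound hub => x [m _ <-]; exists m.
pose w n := sups u n + n.+1%:R^-1.
have w0 n : 0 < w n by rewrite ltr_wpDl ?invr_gt0// (le_trans (u0 n)).
have wmono m n : (m <= n)%N -> w n <= w m.
  move=> mn; rewrite lerD ?nonincreasing_sups// lef_pV2 ?posrE// ler_nat.
  by rewrite ltnS.
have cw : w @ \oo --> (0 : R).
  rewrite -(addr0 0); apply: cvgD; last exact: cvg_harmonic.
  exact: cvg_sups cu.
exists (fun n => Num.sqrt (w n)); split.
- by move=> n; rewrite sqrtr_gt0.
- by move=> m n /wmono; exact: ler_wsqrtr.
- move=> n; rewrite sqr_sqrtr ?(ltW (w0 n))//.
  by rewrite (le_trans (su n))// lerDl invr_ge0.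
- move=> e e0; move/cvgrPdist_le: cw => /(_ (e ^+ 2) (exprn_gt0 _ e0)).
  move=> [N _ wN]; exists N => n Nn.
  rewrite -ler_sqr ?nnegrE ?sqrtr_ge0 ?(ltW e0)// sqr_sqrtr ?(ltW (w0 n))//.
  by have := wN n Nn; rewrite sub0r normrN gtr0_norm.
Qed.

(* The Koopman-von Neumann lemma. *)
Lemma cesaro_density (D : nat -> R) : (forall k, 0 <= D k) ->
  (forall e, 0 < e -> exists N, forall n, (N <= n)%N ->
     \sum_(k < n) D k <= e * n%:R) ->
  exists B : pred nat,
    (forall e, 0 < e -> exists N, forall n, (N <= n)%N ->
       \sum_(k < n | B k) 1 <= e * n%:R) /\
    (forall e, 0 < e -> exists N, forall k, (N <= k)%N -> ~~ B k -> D k <= e).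
Proof.
move=> D0 Dlim.
have [||v [v0 vmono uv vlim]] :=
    @vanishing_square_majorant (fun n => (\sum_(k < n) D k) / n%:R).
- by move=> n; rewrite divr_ge0// sumr_ge0.
- move=> e e0; have [N DN] := Dlim e e0; exists N.+1 => -[//|n] Nn.
  by rewrite ler_pdivrMr// DN// ltnW.
exists (fun k => v k < D k); split; last first.
  move=> e /vlim[N vN]; exists N => k Nk; rewrite -leNgt => /le_trans; apply.
  exact: vN.
move=> e /vlim[N vN]; exists N => n Nn.
have [->|n0] := posnP n; first by rewrite big_ord0 mulr0.
apply: (@le_trans _ _ (v n * n%:R)); last by rewrite ler_wpM2r// vN.
(* Markov's inequality: [v] is nonincreasing, so every bad [k < n] has [D k > v n], while the sum of
   [D] is at most [v n ^+ 2 * n]. *)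
rewrite -(ler_pM2l (v0 n)) mulrA -expr2 -ler_pdivrMr ?ltr0n//.
apply: le_trans (uv n); rewrite ler_pM2r ?invr_gt0 ?ltr0n//.
rewrite mulr_sumr [leRHS](bigID (fun k : 'I_n => v k < D k))/=.
apply: ler_wpDr; first exact: sumr_ge0.
apply: ler_sum => k vD; rewrite mulr1 (le_trans _ (ltW vD))//.
by apply: vmono; exact: ltnW.
Qed.

(** The set meets [[1, r]] only in selected blocks of index at most [r / s], so the frequency of
    selected blocks controls the density. *)
Lemma zero_upper_density_blocks (B : pred nat) s : 0 < s ->
  (forall e, 0 < e -> exists N, forall n, (N <= n)%N ->
     \sum_(k < n | B k) 1 <= e * n%:R) ->
  zero_upper_density (\bigcup_(k in [set k | B k]) `[k%:R * s, k.+1%:R * s[%classic).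
Proof.
move=> s0 Blim; set E := \bigcup_(k in _) _.
have mE : measurable E by apply: bigcup_measurable.
split => //; apply/eqP; rewrite eq_le; apply/andP; split; last first.
  apply: limf_esup_ge0 => [|r].
    by move=> [M [_ /(_ (M + 1))]]; rewrite ltrDl ltr01 => /(_ erefl).
  have [r0|r0] := leP 0 r; first by rewrite mule_ge0// lee_fin invr_ge0.
  by rewrite set_itv_ge ?setI0 ?measure0 ?mule0// bnd_simp -ltNge (lt_trans r0).
apply/lee_addgt0Pr => e e0; rewrite add0e.
have e20 : 0 < e / 2 by rewrite divr_gt0.
have [N BN] := Blim _ e20.
rewrite limf_esupE.
(* Here [1] makes [r] positive, [s] gives [n * s <= 2 * r], and [N * s] ensures [N <= n]. *)
pose M : R := Num.max 1 (Num.max s (N%:R * s)).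
apply: ge_ereal_inf; exists (ereal_sup [set ((r^-1)%:E *
    lebesgue_measure (E `&` `[1%R, r]%classic))%E | r in [set r | M < r]]).
  by exists [set r | M < r] => //; exists M; split => //; exact: num_real.
apply: ge_ereal_sup => _ [r /= Mr <-].
move: Mr; rewrite /M !gt_max => /and3P[r1 rs rN].
have r0 : 0 < r by lra.
pose n := (Num.truncn (r / s)).+1.
have /truncn_itv/andP[nr rn] : 0 <= r / s by rewrite divr_ge0// ltW.
rewrite -/n in rn; rewrite ler_pdivlMr// in nr; rewrite ltr_pdivrMr// in rn.
have Nn : (N <= n)%N.
  by rewrite ltnW// -(@ltr_nat R) -(ltr_pM2r s0) (lt_trans rN).
pose F k : set R := if B k then `[k%:R * s, k.+1%:R * s[%classic else set0.
have sub : E `&` `[1, r] `<=` \big[setU/set0]_(k < n) F k.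
  move=> x [[k /= Bk]]; rewrite !in_itv /= => /andP[kx xk] /andP[_ xr].
  have kn : (k < n)%N.
    by rewrite -(@ltr_nat R) -(ltr_pM2r s0) (le_lt_trans kx)// (le_lt_trans xr).
  rewrite -bigcup_mkord; exists k => //=; rewrite /F Bk /= in_itv /=.
  by rewrite kx xk.
have mes : (lebesgue_measure (E `&` `[1%R, r]%classic) <= (s * \sum_(k < n | B k) 1)%:E)%E.
  apply: (@le_trans _ _ (\sum_(k < n) lebesgue_measure (F k))%E).
    apply: content_subadditive => //; last exact: measurableI.
    by move=> k _; rewrite /F; case: ifP.
  rewrite mulr_sumr -sumEFin [leRHS]big_mkcond /=; apply: lee_sum => k _.
  rewrite /F; case: ifP => _; last by rewrite measure0.
  rewrite lebesgue_measure_itv /= lte_fin ltr_pM2r// ltr_nat ltnSn -EFinB lee_fin.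
  by rewrite -mulrBl -natrB// subSnn mul1r mulr1.
apply: le_trans (lee_wpmul2l _ mes) _; first by rewrite lee_fin invr_ge0 ltW.
rewrite -EFinM lee_fin ler_pdivrMl//.
apply: le_trans (ler_wpM2l (ltW s0) (BN n Nn)) _.
have -> : n%:R = (Num.truncn (r / s))%:R + 1 :> R by rewrite natr1.
set t := (Num.truncn _)%:R in nr *.
have : (e / 2) * (t * s + s) <= (e / 2) * (2 * r) by rewrite ler_wpM2l//; lra.
lra.
Qed.

(** A Borel-type growth lemma. For [r] in the [k]-th block of length [s], [[r, r + s]] lies in two
    consecutive blocks, so [ln G] grows there by at most [D k]. Subexponential growth makes the
    averages of [D] vanish, and [cesaro_density] discards a sparse set of blocks. *)
Lemma slow_growth_off_density_zero (G : R -> R) s : 0 < s ->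
  (forall r, 0 <= r -> 1 <= G r) ->
  (forall r r', 0 <= r -> r <= r' -> G r <= G r') ->
  (forall e, 0 < e -> exists r0, forall r, r0 <= r -> G r <= expR (e * r)) ->
  exists E : set R, zero_upper_density E /\
    forall e, 0 < e -> exists r0, forall r, r0 <= r -> ~ E r ->
      G (r + s) - G r <= e * G r.
Proof.
move=> s0 G1 Gmono Gexp.
have ks0 k : 0 <= k%:R * s by rewrite mulr_ge0// ltW.
have Gp r : 0 <= r -> 0 < G r by move=> /G1; exact: lt_le_trans.
pose L k := ln (G (k%:R * s)).
have Lmono k m : (k <= m)%N -> L k <= L m.
  by move=> km; rewrite ler_ln ?posrE ?Gp// Gmono// ler_wpM2r ?ler_nat// ltW.
have L0 k : 0 <= L k by rewrite ln_ge0 ?G1.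
(* [D] telescopes, so its averages are governed by the growth of [L k / k]. *)
pose D k := L k.+2 - L k.
have D0 k : 0 <= D k by rewrite subr_ge0 Lmono// ltnW.
have SD n : \sum_(k < n) D k = L n + L n.+1 - L 0 - L 1%N.
  elim: n => [|n IH]; first by rewrite big_ord0; ring.
  by rewrite big_ord_recr /= IH /D; ring.
have [|B [Bdens Bgood]] := cesaro_density D0.
  (* The sum of [D] is at most [2 * L n.+1], and [n.+1 <= 2 * n]: these two factors make up the
     [4]. *)
  move=> e e0; have se : 0 < e / (4 * s) by rewrite divr_gt0// mulr_gt0.
  have [r0 Gr0] := Gexp _ se.
  have [N r0N] : exists N, r0 <= N%:R * s.
    exists (Num.truncn (r0 / s)).+1.
    by rewrite -ler_pdivrMr// ltW// truncnS_gt.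
  exists N.+1 => n Nn; rewrite SD.
  have : L n.+1 <= e / (4 * s) * (n.+1%:R * s).
    rewrite /L -[leRHS]expRK ler_ln ?posrE ?expR_gt0 ?Gp//.
    by apply: Gr0; rewrite (le_trans r0N)// ler_wpM2r ?ler_nat ?ltW//; lia.
  have -> : e / (4 * s) * (n.+1%:R * s) = e / 4 * n.+1%:R.
    by field; rewrite gt_eqF.
  have n1 : (1 : R) <= n%:R by rewrite ler1n; lia.
  have : e / 4 * n.+1%:R <= e / 4 * (2 * n%:R).
    have -> : n.+1%:R = n%:R + 1 :> R by rewrite natr1.
    by apply: ler_wpM2l; lra.
  have := Lmono n n.+1 (leqnSn n); have := L0 0; have := L0 1%N.
  lra.
exists (\bigcup_(k in [set k | B k]) `[k%:R * s, k.+1%:R * s[%classic).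
split; first exact: zero_upper_density_blocks.
(* An increase of [ln G] by at most [ln (1 + e)] is a factor of at most [1 + e] for [G]. *)
move=> e e0; have le0 : 0 < ln (1 + e) by rewrite ln_gt0// ltrDl.
have [N BN] := Bgood _ le0.
exists (N%:R * s) => r rN nE.
have r0 : 0 <= r by rewrite (le_trans _ rN).
pose k := Num.truncn (r / s).
have /truncn_itv/andP[] : 0 <= r / s by rewrite divr_ge0// ltW.
rewrite -/k ler_pdivlMr// ltr_pdivrMr// => kr rk.
have Nk : (N <= k)%N.
  by rewrite -ltnS -(@ltr_nat R) -(ltr_pM2r s0) (le_lt_trans rN).
have nB : ~~ B k.
  by apply/negP => Bk; apply: nE; exists k => //=; rewrite in_itv /= kr.
have Dk := BN k Nk nB.
have GE m : G (m%:R * s) = expR (L m) by rewrite lnK ?posrE ?Gp.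
have : G (r + s) <= G (k.+2%:R * s).
  by apply: Gmono; [lra|rewrite -[k.+2%:R]natr1 mulrDl mul1r lerD2r ltW].
have : G (k.+2%:R * s) <= (1 + e) * G (k%:R * s).
  rewrite !GE -[1 + e]lnK ?posrE; last lra.
  by rewrite -expRD ler_expR; rewrite /D in Dk; lra.
have : (1 + e) * G (k%:R * s) <= (1 + e) * G r.
  by rewrite ler_wpM2l ?Gmono//; lra.
lra.
Qed.

End Growth.

(** * The second main theorem *)

Section SecondMainTheorem.
Variable R : realType.
Implicit Types (f g h F : R -> R) (a : tcoord R) (c e k r s x y M K : R) (E : set R).

(** The form in which tropical entire functions are handled, closed under the sums, shifts and
    maxima that build [P_j o f] and the Casoratian. *)
Definition convex_pl h := chord_convex h /\ exists l rho, pl_slopes h l rho.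

Lemma convex_plD g h : convex_pl g -> convex_pl h -> convex_pl (g \+ h).
Proof.
move=> [cg [l [rho sg]]] [ch [l' [rho' sh]]]; split; first exact: chord_convexD.
by exists (l \+ l'), (rho \+ rho'); exact: pl_slopesD.
Qed.

Lemma convex_pl_addl k h : convex_pl h -> convex_pl (fun x => k + h x).
Proof.
apply: (@convex_plD (fun=> k)); split; first exact: chord_convex_cst.
by exists (fun=> 0), (fun=> 0); exact: pl_slopes_cst.
Qed.

Lemma convex_pl_shift c h : convex_pl h -> convex_pl (fun x => h (x + c)).
Proof.
move=> [ch [l [rho sh]]]; split; first exact: chord_convex_shift.
by eexists; eexists; exact: pl_slopes_shift sh.
Qed.

Lemma convex_pl_max g h : convex_pl g -> convex_pl h ->
  convex_pl (fun x => Num.max (g x) (h x)).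
Proof.
move=> [cg [l [rho sg]]] [ch [l' [rho' sh]]]; split; first exact: chord_convex_max.
exact: pl_slopes_max sg sh.
Qed.

Lemma convex_pl_Ncount h r : convex_pl h -> 0 <= r -> Ncount r (\- h) = jensen h r.
Proof. by move=> [ch [l [rho sh]]]; exact: Ncount_jensen sh ch. Qed.

Lemma convex_pl_casorati c g h : convex_pl g -> convex_pl h ->
  convex_pl (tcasorati c g h).
Proof.
move=> cg ch; apply: convex_pl_max.
  exact: convex_plD cg (convex_pl_shift c ch).
exact: convex_plD (convex_pl_shift c cg) ch.
Qed.

(** Pointwise the Casoratian differs from [g + h] by at most the increments of [g] and [h] over the
    shift [c], which [chord_convex_shift_bound] controls. *)
Lemma jensen_casorati_bound c g h : chord_convex g -> chord_convex h ->
  exists K, forall r, 0 <= r ->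
    `|jensen g r + jensen h r - jensen (tcasorati c g h) r| <=
    2 * (jensen g (r + `|c|) - jensen g r + (jensen h (r + `|c|) - jensen h r)) + K.
Proof.
move=> cg ch; set s := `|c|.
have s0 : 0 <= s by exact: normr_ge0.
pose d h x := `|h (x + c) - h x|.
have dC x : `|g x + h x - tcasorati c g h x| <= d g x + d h x.
  rewrite /tcasorati /d distrC ler_distl; apply/andP; split.
    rewrite le_max; apply/orP; left.
    by have := ler_norm (- (h (x + c) - h x)); have := normr_ge0 (g (x + c) - g x);
       rewrite normrN; lra.
  rewrite ge_max; apply/andP; split.
    by have := ler_norm (h (x + c) - h x); have := normr_ge0 (g (x + c) - g x); lra.
  by have := ler_norm (g (x + c) - g x); have := normr_ge0 (h (x + c) - h x); lra.
have dB h' : chord_convex h' -> exists K, forall r, 0 <= r ->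
    d h' r <= 2 * (jensen h' (r + s) - jensen h' r) + K /\
    d h' (- r) <= 2 * (jensen h' (r + s) - jensen h' r) + K.
  move=> ch'; exists (`|h' s - h' 0| + `|h' (- s) - h' 0|) => r r0; split.
    exact: chord_convex_shift_bound.
  (* The point [- r] is the point [r] for the reflected function, with shift [- c]. *)
  have := chord_convex_shift_bound (t := - c) (chord_convex_reflect ch') r0 s0.
  rewrite normrN !jensen_reflect oppr0 opprK opprB /d => /(_ erefl).
  by rewrite [- r + c]addrC [`|h' (- s) - _| + _]addrC.
have [Kg Bg] := dB g cg; have [Kh Bh] := dB h ch.
exists (Kg + Kh + d g 0 + d h 0) => r r0.
have [Bg1 Bg2] := Bg r r0; have [Bh1 Bh2] := Bh r r0.
have := dC r; have := dC (- r); have := dC 0; rewrite /jensen.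
rewrite !ler_norml => /andP[? ?] /andP[? ?] /andP[? ?].
apply/andP; split; rewrite /jensen in Bg1 Bg2 Bh1 Bh2; lra.
Qed.

(** A coordinate equal to [-oo] removes its term from the maximum, and [is_TP1] forbids losing
    both. *)
Lemma tcompE a f0 f1 : is_TP1 a ->
  [\/ exists u v, tcomp a f0 f1 = (fun x => Num.max (u + f0 x) (v + f1 x)),
      exists u, tcomp a f0 f1 = (fun x => u + f0 x)
    | exists v, tcomp a f0 f1 = (fun x => v + f1 x)].
Proof.
case: a => [[a1| |] [a0| |]] [] /=; rewrite /Rmax /tcomp /tpoly /=.
all: move=> H1 H2 H3; rewrite ?eqxx// in H1 H2.
- by apply: Or31; exists a0, a1; apply/funext => x; rewrite -EFin_max.
- by apply: Or33; exists a1; apply/funext => x; rewrite maxNye.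
- by apply: Or32; exists a0; apply/funext => x; rewrite ?maxeNy.
- by case: H3.
Qed.

Lemma tcomp_convex_pl a f0 f1 : is_TP1 a -> convex_pl f0 -> convex_pl f1 ->
  convex_pl (tcomp a f0 f1).
Proof.
move=> /(tcompE f0 f1) + c0 c1.
move=> [[u [v ->]]|[u ->]|[v ->]]; last 2 first.
- exact: convex_pl_addl.
- exact: convex_pl_addl.
by apply: convex_pl_max; exact: convex_pl_addl.
Qed.

Lemma tcomp_jensen_le a f0 f1 : is_TP1 a ->
  exists K, forall r, jensen (tcomp a f0 f1) r <= Tchar f0 f1 r + K.
Proof.
move=> /(tcompE f0 f1) H.
have [M PM] : exists M, forall x, tcomp a f0 f1 x <= tnorm f0 f1 x + M.
  case: H => [[u [v ->]]|[u ->]|[v ->]].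
  - exists (Num.max u v) => x; rewrite /tnorm ge_max; apply/andP; split.
      by rewrite addrC lerD ?le_max ?lexx ?orbT.
    by rewrite addrC lerD ?le_max ?lexx ?orbT.
  - by exists u => x; rewrite addrC lerD2r le_max lexx.
  - by exists v => x; rewrite addrC lerD2r le_max lexx orbT.
exists (M + tnorm f0 f1 0 - tcomp a f0 f1 0) => r.
by have := PM r; have := PM (- r); rewrite /jensen /Tchar; lra.
Qed.

(** Nondegeneracy rules out the one-term cases; both coefficients are then finite, and [tnorm] is at
    most [tcomp] plus a constant. *)
Lemma tcomp_jensen_ge a f0 f1 : is_TP1 a -> ~~ (ell f0 f1 (tcomp a f0 f1) < 2)%N ->
  exists K, forall r, Tchar f0 f1 r <= jensen (tcomp a f0 f1) r + K.
Proof.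
move=> aT; rewrite /ell; case: asboolP => // nell _.
have [u [v PE]] : exists u v,
    tcomp a f0 f1 = (fun x => Num.max (u + f0 x) (v + f1 x)).
  case: (tcompE f0 f1 aT) => // [[u PE]|[v PE]]; exfalso; apply: nell.
    by exists u; left=> x; rewrite PE.
  by exists v; right=> x; rewrite PE.
have PM x : tnorm f0 f1 x <= tcomp a f0 f1 x + Num.max (- u) (- v).
  rewrite PE /tnorm; set m := Num.max (- u) _; set p := Num.max (u + _) _.
  have [um vm] : - u <= m /\ - v <= m by split; rewrite le_max lexx ?orbT.
  have [up vp] : u + f0 x <= p /\ v + f1 x <= p by split; rewrite le_max lexx ?orbT.
  by rewrite ge_max; apply/andP; split; lra.
exists (Num.max (- u) (- v) + tcomp a f0 f1 0 - tnorm f0 f1 0) => r.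
by have := PM r; have := PM (- r); rewrite /jensen /Tchar; lra.
Qed.

(** In the lower bound a degenerate member contributes only the nonnegativity of [jensen], any other
    a full [Tchar] up to a constant; hence the loss of [ddg]. *)
Lemma sum_jensen_bounds (a : nat -> tcoord R) f0 f1 (js : seq nat) :
  convex_pl f0 -> convex_pl f1 -> {in js, forall j, is_TP1 (a j)} ->
  exists K, forall r, 0 <= r ->
    let B := \sum_(j <- js) jensen (tcomp (a j) f0 f1) r in
    ((size js)%:R - (ddg f0 f1 [seq tcomp (a j) f0 f1 | j <- js])%:R) * Tchar f0 f1 r
      <= B + K /\
    B <= (size js)%:R * Tchar f0 f1 r + K.
Proof.
move=> c0 c1; elim: js => [_|j js IH aT].
  by exists 0 => r r0 /=; rewrite big_nil /ddg /= subrr !mul0r !addr0.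
have /IH[K HK] : {in js, forall j, is_TP1 (a j)}.
  by move=> i ijs; apply: aT; rewrite inE ijs orbT.
have aj : is_TP1 (a j) by apply: aT; rewrite mem_head.
have [K1 HK1] := tcomp_jensen_le f0 f1 aj.
have [K2 K20 HK2] : exists2 K2, 0 <= K2 & forall r, 0 <= r ->
    (1 - (ell f0 f1 (tcomp (a j) f0 f1) < 2)%N%:R) * Tchar f0 f1 r <=
    jensen (tcomp (a j) f0 f1) r + K2.
  have [lt2|nlt2] := boolP (ell f0 f1 (tcomp (a j) f0 f1) < 2)%N.
    exists 0 => // r r0; rewrite subrr mul0r addr0.
    by apply: jensen_ge0 => //; have [] := tcomp_convex_pl aj c0 c1.
  have [K2 HK2] := tcomp_jensen_ge aj nlt2; exists `|K2| => // r r0.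
  by rewrite subr0 mul1r (le_trans (HK2 r))// lerD2l ler_norm.
exists (`|K| + `|K1| + K2) => r r0 /=; have [HB1 HB2] := HK r r0.
have := HK2 r r0; have := HK1 r; rewrite big_cons /ddg /= natrD -natr1.
have := ler_norm K; have := ler_norm K1.
set B := \sum_(_ <- _) _ in HB1 HB2 *.
set m := (count _ _)%:R; rewrite /ddg -/m in HB1.
by have := normr_ge0 K1; move=> *; split; lra.
Qed.

Lemma littleo_off E (g T : R -> R) :
  (forall e, 0 < e -> exists r0, forall r, r0 <= r -> ~ E r -> `|g r| <= e * `|T r|) ->
  g =o_ (oo_off E) T.
Proof.
move=> H; apply/eqoP => e e0; have [r0 Hr0] := H e e0.
exists r0; split; first exact: num_real.
by move=> r rr0 nE; apply: Hr0 => //; exact: ltW.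
Qed.

Lemma subexponential_upper_bound (T : R -> R) :
  limf_esup (fun r : R => (ln (T r) / r)%:E) (+oo)%R = 0%E ->
  forall e, 0 < e -> exists r0, forall r, r0 <= r -> ln (T r) <= e * r.
Proof.
move=> lim0 e e0.
have : (limf_esup (fun r : R => (ln (T r) / r)%:E) (+oo)%R < e%:E)%E.
  by rewrite lim0 lte_fin.
rewrite limf_esupE => /ereal_inf_lt[_ [V [M [_ VM]] <-] supV].
exists (Num.max 1 (M + 1)) => r; rewrite ge_max => /andP[r1 Mr].
have r0 : 0 < r by lra.
rewrite -ler_pdivrMr// -lee_fin; apply: le_trans (ltW supV).
by apply: ereal_sup_ubound; exists r => //; apply: VM; lra.
Qed.

End SecondMainTheorem.

(** * The Casoratian error term *)

Section CasoratiError.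
Variable R : realType.

Lemma Tchar_unbounded (f0 f1 : R -> R) : chord_convex f0 -> chord_convex f1 ->
  ~ (exists k, forall x, f1 x - f0 x = k) ->
  forall M, exists r0, forall r, r0 <= r -> M <= Tchar f0 f1 r.
Proof. by move=> c0 c1 ncst M; exact: (jensen_max_unbounded c0 c1 ncst). Qed.

(** The increments in [jensen_casorati_bound] are dominated by those of [G], and [G] stays below
    [4 * T], so slow growth of [G] makes the error small against [T]. *)
Lemma casorati_error (c : R) (f0 f1 : R -> R) (a1 a2 : tcoord R) :
  c != 0 -> convex_pl f0 -> convex_pl f1 ->
  ~ (exists k, forall x, f1 x - f0 x = k) ->
  limf_esup (fun r : R => (ln (Tchar f0 f1 r) / r)%:E) (+oo)%R = 0%E ->
  is_TP1 a1 -> is_TP1 a2 ->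
  let P1 := tcomp a1 f0 f1 in let P2 := tcomp a2 f0 f1 in
  exists E : set R, zero_upper_density E /\
    forall e, 0 < e -> exists r0, forall r, r0 <= r -> ~ E r ->
      `|jensen P1 r + jensen P2 r - jensen (tcasorati c P1 P2) r|
        <= e * Tchar f0 f1 r.
Proof.
move=> c0 cf0 cf1 ncst lim0 t1 t2 P1 P2.
have [cP1 _] : convex_pl P1 by exact: tcomp_convex_pl.
have [cP2 _] : convex_pl P2 by exact: tcomp_convex_pl.
have Tbig := Tchar_unbounded cf0.1 cf1.1 ncst.
pose T := Tchar f0 f1; rewrite -/T in Tbig lim0 *.
have cT : chord_convex (tnorm f0 f1) by apply: chord_convex_max cf0.1 cf1.1.
have TE r : T r = jensen (tnorm f0 f1) r by [].
have [K1 JP1] := tcomp_jensen_le f0 f1 t1.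
have [K2 JP2] := tcomp_jensen_le f0 f1 t2.
have [K err] := jensen_casorati_bound c cP1 cP2.
pose s := `|c|; have s0 : 0 < s by rewrite normr_gt0.
rewrite -/P1 -/P2 -/T -/s in JP1 JP2 err *.
pose G r := 1 + (T r + jensen P1 r + jensen P2 r).
have Gmono r r' : 0 <= r -> r <= r' -> G r <= G r'.
  move=> r0 rr'; rewrite /G !TE lerD2l.
  by apply: lerD; [apply: lerD|]; exact: jensen_homo.
have [rT TG] : exists r0, forall r, r0 <= r -> G r <= 4 * T r.
  (* [G] is at most [3 * T + (1 + K1 + K2)], and the constant is eventually below [T]. *)
  have [r0 Tr0] := Tbig (1 + K1 + K2).
  by exists r0 => r /Tr0; have := JP1 r; have := JP2 r; rewrite /G; lra.
have [|||E [dE Eslow]] := @slow_growth_off_density_zero R G s s0.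
- by move=> r r0; rewrite /G TE lerDl; apply: addr_ge0; [apply: addr_ge0|]; exact: jensen_ge0.
- exact: Gmono.
- move=> e e0; have e20 : 0 < e / 2 by lra.
  have [r1 lnT] := subexponential_upper_bound lim0 e20.
  have [r2 T1] := Tbig 1.
  (* Half of the exponent pays for [T], the other half for the factor [4]; [1 <= T r] lets [expR]
     undo [ln]. *)
  exists (Num.max (Num.max rT r1) (Num.max r2 (ln 4 / (e / 2)))) => r.
  rewrite !ge_max => /andP[/andP[rTr /lnT lnTr] /andP[/T1 T1r]].
  rewrite ler_pdivrMr// [r * _]mulrC => ln4.
  apply: le_trans (TG r rTr) _.
  have -> : e * r = e / 2 * r + e / 2 * r by field.
  rewrite expRD ler_pM//; first by lra.
    by rewrite -[leLHS]lnK ?posrE// ler_expR.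
  by rewrite -[leLHS]lnK ?posrE ?ler_expR//; lra.
exists E; split=> // e e0.
(* The error is at most [2 * (e / 16) * (4 * T) + K]: the first term takes [e / 2 * T], and [K] fits
   in the other half. *)
have e0' : 0 < e / 16 by lra.
have [r1 slow] := Eslow _ e0'; have [r2 TK] := Tbig (K / (e / 2)).
exists (Num.max (Num.max 0 rT) (Num.max r1 r2)) => r; rewrite !ge_max.
move=> /andP[/andP[r0 /TG Gr] /andP[r1r /TK]]; rewrite ler_pdivrMr; last lra.
move=> KT nE; apply: le_trans (err r r0) _.
have := slow r r1r nE.
have : T r <= T (r + s) by rewrite !TE jensen_homo// lerDl ltW.
have : e / 16 * G r <= e / 16 * (4 * T r) by rewrite ler_wpM2l// ltW.
rewrite [G (_ + _)]/G {2}/G; lra.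
Qed.

End CasoratiError.

Theorem theorem6p3 (R : realType) (c : R) (f f0 f1 : R -> R)
    (q : nat) (a : nat -> tcoord R) (lambda : nat) :
  c != 0 ->
  tropical_meromorphic f ->
  tropical_quotient f f0 f1 ->
  ~ (exists k : R, forall x, f x = k) ->
  limf_esup (fun r : R => (ln (Tchar f0 f1 r) / r)%:E) (+oo)%R = 0%E ->
  (2 <= q)%N ->
  (forall j, (1 <= j <= q)%N -> is_TP1 (a j)) ->
  (forall i j, (1 <= i <= q)%N -> (1 <= j <= q)%N -> i <> j ->
     ~ TP1_eq (a i) (a j)) ->
  ddg f0 f1 [seq tcomp (a j) f0 f1 | j <- index_iota 3 q.+1] = lambda ->
  let T := Tchar f0 f1 in
  let P := fun j => tcomp (a j) f0 f1 in
  let A := fun r : R => \sum_(1 <= j < q.+1) Ncount r (\- P j)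
                        - Ncount r (\- tcasorati c (P 1%N) (P 2%N)) in
  let B := fun r : R => \sum_(3 <= j < q.+1) Ncount r (\- P j) in
  (exists E : set R, zero_upper_density E /\
    exists s1 s2 s3 : R -> R,
      [/\ s1 =o_ (oo_off E) T,
          s2 =o_ (oo_off E) T,
          s3 =o_ (oo_off E) T
        & \forall r \near oo_off E,
            [/\ (q%:R - 2 - lambda%:R) * T r <= A r + s1 r,
                A r + s1 r <= B r + s2 r
              & B r + s2 r <= (q%:R - 2) * T r + s3 r]])
  /\
  (lambda = 0%N ->
   exists E : set R, zero_upper_density E /\
    exists s1 s2 : R -> R,
      [/\ s1 =o_ (oo_off E) T,
          s2 =o_ (oo_off E) T
        & \forall r \near oo_off E,
            (q%:R - 2) * T r = A r + s1 r /\ A r + s1 r = B r + s2 r]).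
Proof.
move=> c0 _ [ef0 ef1 _ fE] ncst lim0 q2 aT _ lamE T P A B.
have cf0 : convex_pl f0 by exact: tropical_entire_pl_convex.
have cf1 : convex_pl f1 by exact: tropical_entire_pl_convex.
have ncst' : ~ (exists k, forall x, f1 x - f0 x = k).
  by move=> [k kE]; apply: ncst; exists k => x; rewrite fE.
have cP j : (1 <= j <= q)%N -> convex_pl (P j).
  by move=> /aT aj; exact: tcomp_convex_pl.
have t1 : (1 <= 1 <= q)%N by rewrite (ltnW q2).
have t2 : (1 <= 2 <= q)%N by rewrite q2.
have [E [dE Eerr]] := casorati_error c0 cf0 cf1 ncst' lim0 (aT _ t1) (aT _ t2).
have Tbig := Tchar_unbounded cf0.1 cf1.1 ncst'.
rewrite -/T -/(P 1%N) -/(P 2%N) in lim0 Eerr Tbig.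
have js3 : {in index_iota 3 q.+1, forall j, is_TP1 (a j)}.
  by move=> j; rewrite mem_index_iota => /andP[j3 jq]; apply: aT; lia.
have [K KB] := sum_jensen_bounds cf0 cf1 js3.
have qE : (size (index_iota 3 q.+1))%:R = q%:R - 2 :> R.
  by rewrite size_iota -natrB//; congr (_%:R); lia.
rewrite lamE qE -/T in KB.
have BE r : 0 <= r -> B r = \sum_(j <- index_iota 3 q.+1) jensen (P j) r.
  move=> r0; rewrite /B !big_seq; apply: eq_bigr => j.
  rewrite mem_index_iota => /andP[j3 jq].
  by apply: convex_pl_Ncount => //; apply: cP; lia.
have AB r : 0 <= r -> A r - B r = jensen (P 1%N) r + jensen (P 2%N) r
    - jensen (tcasorati c (P 1%N) (P 2%N)) r.
  move=> r0; rewrite /A big_ltn ?ltnS ?(ltnW q2)// big_ltn// -/(B r).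
  rewrite !convex_pl_Ncount//; [ring| | |]; last 2 first.
  - exact: cP.
  - exact: cP.
  by apply: convex_pl_casorati; exact: cP.
have BK r : 0 <= r -> (q%:R - 2 - lambda%:R) * T r <= B r + K /\
    B r <= (q%:R - 2) * T r + K.
  by move=> r0; have := KB r r0; rewrite BE.
have o_cst (M e : R) : 0 < e -> exists r0, forall r, r0 <= r -> `|M| <= e * T r.
  move=> e0; have [r0 Tr0] := Tbig (`|M| / e).
  by exists r0 => r /Tr0; rewrite ler_pdivrMr// mulrC.
(* Every error term below is bounded by the Casoratian error [A - B] in absolute value plus a
   constant, which the growth of [T] absorbs. *)
have oP (g : R -> R) : (exists M : R, forall r, 0 <= r -> `|g r| <= `|A r - B r| + `|M|) ->
    g =o_ (oo_off E) T.
  move=> [M gM]; apply: littleo_off => e e0; have e20 : 0 < e / 2 by lra.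
  have [r1 err] := Eerr _ e20; have [r2 cst] := o_cst M _ e20.
  exists (Num.max 0 (Num.max r1 r2)) => r; rewrite !ge_max => /and3P[r0 r1r r2r] nE.
  have := err r r1r nE; have := cst r r2r; have := gM r r0.
  have : e * T r <= e * `|T r| by rewrite ler_wpM2l ?ler_norm// ltW.
  by rewrite AB//; lra.
have nearP (Q : R -> Prop) : (forall r, 0 <= r -> Q r) -> \forall r \near oo_off E, Q r.
  move=> H; exists 0; split; first exact: num_real.
  by move=> r r0 _; exact/H/ltW.
split=> [|lam0]; exists E; split=> //.
  (* With this choice [A + s1] and [B + s2] both equal [B + K]; the extra [K] in [s3] pays for the
     upper bound on [B]. *)
  exists (fun r => B r - A r + K), (fun=> K), (fun=> 2 * K); split.
  - apply: oP; exists K => r _.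
    by rewrite (le_trans (ler_normD _ _))// distrC.
  - by apply: oP; exists K => r _; rewrite lerDr.
  - by apply: oP; exists (2 * K) => r _; rewrite lerDr.
  - by apply: nearP => r /BK[? ?]; split; lra.
rewrite lam0 subr0 in BK.
(* Exact differences turn both equations into identities; their smallness comes from [BK], two-sided
   once [lambda] vanishes. *)
exists (fun r => (q%:R - 2) * T r - A r), (fun r => (q%:R - 2) * T r - B r); split.
- apply: oP; exists K => r /BK[? ?].
  have -> : (q%:R - 2) * T r - A r = (B r - A r) + ((q%:R - 2) * T r - B r) by ring.
  rewrite (le_trans (ler_normD _ _))// distrC lerD2l.
  by rewrite (le_trans _ (ler_norm K))// ler_norml; apply/andP; split; lra.
- apply: oP; exists K => r /BK[? ?]; apply: ler_wpDl => //.
  by rewrite (le_trans _ (ler_norm K))// ler_norml; apply/andP; split; lra.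
- by apply: nearP => r _; split; ring.
Qed.
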